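(* Let $\mathcal P$ be an exact category with a suitable bi-exact tensor product, and let $M$ and $N$ be bounded complexes in $\mathcal P$ concentrated in non-negative degrees. Let $j \ge 0$ be an integer. (i) If $\chi_r(M) = 0$ and $\chi_r(N) = 0$ for all $0 \le r < j$, then, in $K_0(\mathcal P)$, $$\chi_k(M \otimes N) = 0 \quad \text{for } 0 \le k < 2j,$$ $$\chi_{2j}(M \otimes N) = \chi_j(M)\,\chi_j(N),$$ $$\chi_{2j+1}(M \otimes N) = \chi_j(M)\,\chi_{j+1}(N) + \chi_{j+1}(M)\,\chi_j(N).$$ (ii) If $M = CN$ is the cone of a self-map $N \to N$, then $\chi_{j+1}(M) = \chi_j(N)$. (iii) Let $M = C^j(N) = C(\cdots C(N) \cdots)$ be a $j$-fold iterated cone on $N$. Then $\chi_j(M) = \chi(N)$, $\chi_{k+j}(M) = \chi_k(N)$ for all $k \ge 0$, and $$\chi_0(M) = 0, \ \ldots, \ \chi_{j-1}(M) = 0.$$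
   Context: $\mathcal P$ is an exact category with a suitable notion of tensor product (bi-exact, associative, commutative and unital up to natural isomorphism, so that $K_0(\mathcal P)$ is a commutative ring with product $[A][B] = [A \otimes B]$), symmetric power and exterior power (the symmetric and exterior powers do not enter the statement). Examples are vector bundles on a scheme, or finitely generated projective modules over a commutative ring. $[A]$ denotes the class of an object $A$ in the Grothendieck ring $K_0(\mathcal P)$. For a bounded complex $M$ over $\mathcal P$ with terms $M_i$, put $\chi(M) = \sum_i (-1)^i [M_i] \in K_0(\mathcal P)$ and, for each integer $j \ge 0$, $$\chi_j(M) = \sum_i (-1)^{i-j} \binom{i}{j} [M_i] \in K_0(\mathcal P),$$ so $\chi_0 = \chi$. The tensor product $M \otimes N$ of complexes is the usual total complex, with $(M \otimes N)_n = \bigoplus_{a+b=n} M_a \otimes N_b$. The cone $CN$ of a self-map $N \to N$ of a complex concentrated in non-negative degrees is the mapping cone, indexed so that $(CN)_0 = N_0$ and $(CN)_i = N_i \oplus N_{i-1}$ for $i > 0$. A $j$-fold iterated cone on $N$ is a complex obtained from $N$ by $j$ times successively forming the cone of a self-map of the complex obtained at the previous stage. *)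

(* Defs.v *)
From HB Require Import structures.
From mathcomp Require Import all_boot all_order all_algebra.
From mathcomp Require Import boolp classical_sets fsbigop.
From mathcomp Require Import freeg.

Set Implicit Arguments.
Unset Strict Implicit.
Unset Printing Implicit Defensive.

Import GRing.Theory.
Local Open Scope ring_scope.

Record preadditive := Preadditive {
  obj :> Type;
  hom : obj -> obj -> zmodType;
  idm : forall A, hom A A;
  comp : forall A B C, hom B C -> hom A B -> hom A C;
  compA : forall A B C D (h : hom C D) (g : hom B C) (f : hom A B),
    comp h (comp g f) = comp (comp h g) f;
  comp1m : forall A B (f : hom A B), comp (idm B) f = f;
  compm1 : forall A B (f : hom A B), comp f (idm A) = f;
  compDl : forall A B C (g g' : hom B C) (f : hom A B),
    comp (g + g') f = comp g f + comp g' f;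
  compDr : forall A B C (g : hom B C) (f f' : hom A B),
    comp g (f + f') = comp g f + comp g f'
}.

Arguments hom {p} A B.
Arguments idm {p} A.
Arguments comp {p A B C} g f.
Notation "g ∘ f" := (comp g f) (at level 40, left associativity).

Definition is_iso (C : preadditive) (A B : C) (f : hom A B) :=
  exists2 g : hom B A, g ∘ f = idm A & f ∘ g = idm B.

Definition is_zero_obj (C : preadditive) (A : C) :=
  forall X : C, (forall f : hom A X, f = 0) /\ (forall f : hom X A, f = 0).

Record additive_cat := AdditiveCat {
  acat :> preadditive;
  zob : acat;
  zobP : is_zero_obj zob;
  biprod : acat -> acat -> acat;
  injl : forall A B, hom A (biprod A B);
  injr : forall A B, hom B (biprod A B);
  projl : forall A B, hom (biprod A B) A;
  projr : forall A B, hom (biprod A B) B;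
  projl_injl : forall A B, projl A B ∘ injl A B = idm A;
  projr_injr : forall A B, projr A B ∘ injr A B = idm B;
  projl_injr : forall A B, projl A B ∘ injr A B = 0;
  projr_injl : forall A B, projr A B ∘ injl A B = 0;
  biprod_id : forall A B,
    injl A B ∘ projl A B + injr A B ∘ projr A B = idm (biprod A B)
}.

Arguments zob {a}.
Arguments biprod {a} A B.
Arguments injl {a} A B.
Arguments injr {a} A B.
Arguments projl {a} A B.
Arguments projr {a} A B.

Section KernelCokernel.
Variable C : preadditive.

Definition is_kernel (A B D : C) (i : hom A B) (p : hom B D) :=
  p ∘ i = 0 /\
  forall (X : C) (f : hom X B), p ∘ f = 0 -> exists! g : hom X A, i ∘ g = f.

Definition is_cokernel (A B D : C) (i : hom A B) (p : hom B D) :=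
  p ∘ i = 0 /\
  forall (X : C) (f : hom B X), f ∘ i = 0 -> exists! g : hom D X, g ∘ p = f.

Definition is_pushout (A B A' B' : C) (i : hom A B) (f : hom A A')
    (i' : hom A' B') (f' : hom B B') :=
  i' ∘ f = f' ∘ i /\
  forall (X : C) (u : hom A' X) (v : hom B X), u ∘ f = v ∘ i ->
    exists! w : hom B' X, w ∘ i' = u /\ w ∘ f' = v.

Definition is_pullback (B D B' D' : C) (p : hom B D) (f : hom D' D)
    (p' : hom B' D') (f' : hom B' B) :=
  f ∘ p' = p ∘ f' /\
  forall (X : C) (u : hom X D') (v : hom X B), f ∘ u = p ∘ v ->
    exists! w : hom X B', p' ∘ w = u /\ f' ∘ w = v.

End KernelCokernel.

(* Quillen's axioms for the class of conflations (short exact sequences), in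
   the form with pushouts of inflations and pullbacks of deflations. *)
Record exact_cat := ExactCat {
  ecat :> additive_cat;
  conflation : forall A B D : ecat, hom A B -> hom B D -> Prop;
  inflation : forall A B : ecat, hom A B -> Prop :=
    fun A B i => exists (D : ecat) (p : hom B D), conflation i p;
  deflation : forall B D : ecat, hom B D -> Prop :=
    fun B D p => exists (A : ecat) (i : hom A B), conflation i p;
  conflation_ker : forall (A B D : ecat) (i : hom A B) (p : hom B D),
    conflation i p -> is_kernel i p;
  conflation_coker : forall (A B D : ecat) (i : hom A B) (p : hom B D),
    conflation i p -> is_cokernel i p;
  conflation_iso : forall (A B D A' B' D' : ecat)
      (i : hom A B) (p : hom B D) (i' : hom A' B') (p' : hom B' D')
      (a : hom A A') (b : hom B B') (d : hom D D'),
    is_iso a -> is_iso b -> is_iso d ->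
    b ∘ i = i' ∘ a -> d ∘ p = p' ∘ b ->
    conflation i p -> conflation i' p';
  inflation_id : forall A : ecat, inflation (idm A);
  deflation_id : forall A : ecat, deflation (idm A);
  inflation_comp : forall (A B D : ecat) (i : hom A B) (j : hom B D),
    inflation i -> inflation j -> inflation (j ∘ i);
  deflation_comp : forall (A B D : ecat) (p : hom A B) (q : hom B D),
    deflation p -> deflation q -> deflation (q ∘ p);
  inflation_pushout : forall (A B A' : ecat) (i : hom A B) (f : hom A A'),
    inflation i -> exists (B' : ecat) (i' : hom A' B') (f' : hom B B'),
      is_pushout i f i' f' /\ inflation i';
  deflation_pullback : forall (B D D' : ecat) (p : hom B D) (f : hom D' D),
    deflation p -> exists (B' : ecat) (p' : hom B' D') (f' : hom B' B),
      is_pullback p f p' f' /\ deflation p'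
}.

(* No coherence (pentagon, hexagon, triangle) is asked of the natural
   isomorphisms: their existence already makes K0 a commutative ring. *)
Record tensor_cat := TensorCat {
  tcat :> exact_cat;
  ten : tcat -> tcat -> tcat;
  tenm : forall A A' B B' : tcat,
    hom A A' -> hom B B' -> hom (ten A B) (ten A' B');
  tenm_id : forall A B : tcat, tenm (idm A) (idm B) = idm (ten A B);
  tenm_comp : forall (A A' A'' B B' B'' : tcat) (f' : hom A' A'')
      (f : hom A A') (g' : hom B' B'') (g : hom B B'),
    tenm (f' ∘ f) (g' ∘ g) = tenm f' g' ∘ tenm f g;
  tenmDl : forall (A A' B B' : tcat) (f f' : hom A A') (g : hom B B'),
    tenm (f + f') g = tenm f g + tenm f' g;
  tenmDr : forall (A A' B B' : tcat) (f : hom A A') (g g' : hom B B'),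
    tenm f (g + g') = tenm f g + tenm f g';
  ten_exactl : forall (A B D X : tcat) (i : hom A B) (p : hom B D),
    conflation i p -> conflation (tenm i (idm X)) (tenm p (idm X));
  ten_exactr : forall (A B D X : tcat) (i : hom A B) (p : hom B D),
    conflation i p -> conflation (tenm (idm X) i) (tenm (idm X) p);
  tassoc : forall A B D : tcat, hom (ten A (ten B D)) (ten (ten A B) D);
  tassoc_iso : forall A B D : tcat, is_iso (tassoc A B D);
  tassoc_nat : forall (A A' B B' D D' : tcat)
      (f : hom A A') (g : hom B B') (h : hom D D'),
    tassoc A' B' D' ∘ tenm f (tenm g h) = tenm (tenm f g) h ∘ tassoc A B D;
  braid : forall A B : tcat, hom (ten A B) (ten B A);
  braid_iso : forall A B : tcat, is_iso (braid A B);
  braid_nat : forall (A A' B B' : tcat) (f : hom A A') (g : hom B B'),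
    braid A' B' ∘ tenm f g = tenm g f ∘ braid A B;
  tunit : tcat;
  unitl : forall A : tcat, hom (ten tunit A) A;
  unitl_iso : forall A : tcat, is_iso (unitl A);
  unitl_nat : forall (A A' : tcat) (f : hom A A'),
    unitl A' ∘ tenm (idm tunit) f = f ∘ unitl A;
  unitr : forall A : tcat, hom (ten A tunit) A;
  unitr_iso : forall A : tcat, is_iso (unitr A);
  unitr_nat : forall (A A' : tcat) (f : hom A A'),
    unitr A' ∘ tenm f (idm tunit) = f ∘ unitr A
}.

Arguments ten {t} A B.
Arguments tenm {t A A' B B'} f g.
Arguments tunit {t}.

Section K0Group.
Variable P : tensor_cat.

Local Notation F := {freeg {classic P} / int}.

Definition fgen (A : P) : F := << (A : {classic P}) >>.

(* The subgroup generated by the [B] - ([A] + [D]), for A -> B -> D exact. *)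
Inductive K0_span : F -> Prop :=
| K0_span0 : K0_span 0
| K0_spanB x y : K0_span x -> K0_span y -> K0_span (x - y)
| K0_span_conflation (A B D : P) (i : hom A B) (p : hom B D) :
    conflation i p -> K0_span (fgen B - (fgen A + fgen D)).

Definition K0_rel : {pred F} := fun x => `[< K0_span x >].

Lemma K0_rel_closed : zmod_closed K0_rel.
Proof.
split; first by apply/asboolP; exact: K0_span0.
by move=> x y /asboolP hx /asboolP hy; apply/asboolP; exact: K0_spanB.
Qed.

HB.instance Definition _ := GRing.isZmodClosed.Build F K0_rel K0_rel_closed.

Definition K0 := Quotient.quot K0_rel.

HB.instance Definition _ := GRing.Zmodule.on K0.

Definition K0_pi (x : F) : K0 := (\pi_(Quotient.quot K0_rel) x)%qT.

Definition cls (A : P) : K0 := K0_pi (fgen A).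

(* Bilinear extension of ten to formal Z-linear combinations of objects. *)
Definition fmul (x y : F) : F :=
  fglift (fun A : {classic P} =>
    fglift (fun B : {classic P} => fgen (ten (A : P) (B : P))) y) x.

Definition K0_mul (x y : K0) : K0 := K0_pi (fmul (repr x) (repr y)).

Lemma K0_piB x y : K0_pi (x - y) = K0_pi x - K0_pi y.
Proof. exact: (raddfB (\pi_(Quotient.quot K0_rel))%qT). Qed.

Lemma K0_piP x y : K0_pi x = K0_pi y <-> K0_span (x - y).
Proof.
split=> [|h]; rewrite /K0_pi.
  by move/eqP; rewrite -Quotient.idealrBE => /asboolP.
by apply/eqP; rewrite -Quotient.idealrBE; apply/asboolP.
Qed.

Lemma K0_pi0 : K0_pi 0 = 0.
Proof. by rewrite -(subrr 0) K0_piB subrr. Qed.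

Lemma K0_piN x : K0_pi (- x) = - K0_pi x.
Proof. by rewrite -sub0r K0_piB K0_pi0 sub0r. Qed.

Lemma K0_piD x y : K0_pi (x + y) = K0_pi x + K0_pi y.
Proof. by rewrite -{1}[y]opprK K0_piB K0_piN opprK. Qed.

Lemma K0_piK (x : K0) : K0_pi (repr x) = x.
Proof. exact: reprK. Qed.

Lemma cls_conflation (A B D : P) (i : hom A B) (p : hom B D) :
  conflation i p -> cls B = cls A + cls D.
Proof.
move=> hip; rewrite /cls -K0_piD; apply/K0_piP; exact: (K0_span_conflation hip).
Qed.

Lemma is_iso_idm (A : P) : is_iso (idm A).
Proof. by exists (idm A); rewrite comp1m. Qed.

Lemma cls_iso (A B : P) (f : hom A B) : is_iso f -> cls A = cls B.
Proof.
move=> fiso; have [g gf fg] := fiso.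
have [D [p hp]] := inflation_id A.
have hA := cls_conflation hp.
have hB : conflation f (p ∘ g).
  apply: (conflation_iso (is_iso_idm A) fiso (is_iso_idm D) _ _ hp).
    by [].
  by rewrite comp1m -compA gf compm1.
have {hA} D0 : cls D = 0 by apply: (addrI (cls A)); rewrite addr0.
by rewrite (cls_conflation hB) D0 addr0.
Qed.

Lemma fgen_ind (Q : F -> Prop) :
  Q 0 -> (forall x y, Q x -> Q y -> Q (x - y)) -> (forall A, Q (fgen A)) ->
  forall x, Q x.
Proof.
move=> Q0 QB Qg x.
have QN y : Q y -> Q (- y) by rewrite -sub0r; exact: QB.
have QD y z : Q y -> Q z -> Q (y + z).
  by move=> hy hz; rewrite -[z]opprK; apply: QB => //; apply: QN.
have QM y n : Q y -> Q (y *+ n).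
  by move=> hy; elim: n => [|n IHn]; rewrite ?mulr0n // mulrS; apply: QD.
elim/freeg_ind_dom0: x => // k A x _ _ Qx; apply: QD => //.
have -> : << k *g A >> = fgen A *~ k by rewrite /fgen freegU_mulz intz.
by case: k => n; [exact: QM | apply/QN/QM].
Qed.

Lemma fmulBl x y z : fmul (x - y) z = fmul x z - fmul y z.
Proof. exact: lift_is_additive. Qed.

Lemma fmul0l z : fmul 0 z = 0.
Proof. by have := fmulBl 0 0 z; rewrite !subrr. Qed.

Lemma fmul_gen A B : fmul (fgen A) (fgen B) = fgen (ten A B).
Proof. by rewrite /fmul liftU scale1r liftU scale1r. Qed.

Lemma fmul_genl A y : fmul (fgen A) y =
  fglift (fun B : {classic P} => fgen (ten A (B : P))) y.
Proof. by rewrite /fmul liftU scale1r. Qed.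

Lemma fmulBr x y z : fmul x (y - z) = fmul x y - fmul x z.
Proof.
elim/fgen_ind: x => [|x1 x2 h1 h2|A]; first by rewrite !fmul0l subr0.
  by rewrite !fmulBl h1 h2 !opprD addrACA.
by rewrite !fmul_genl lift_is_additive.
Qed.

Lemma fmul0r x : fmul x 0 = 0.
Proof. by have := fmulBr x 0 0; rewrite !subrr. Qed.

Lemma fmul_genB A B D X :
  fmul (fgen B - (fgen A + fgen D)) (fgen X) =
  fgen (ten B X) - (fgen (ten A X) + fgen (ten D X)).
Proof.
rewrite fmulBl fmul_gen -[fgen D]opprK fmulBl fmul_gen.
by rewrite -[- fgen D]sub0r fmulBl fmul0l sub0r fmul_gen opprK.
Qed.

Lemma fmul_genBr A B D X :
  fmul (fgen X) (fgen B - (fgen A + fgen D)) =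
  fgen (ten X B) - (fgen (ten X A) + fgen (ten X D)).
Proof.
rewrite fmulBr fmul_gen -[fgen D]opprK fmulBr fmul_gen.
by rewrite -[- fgen D]sub0r fmulBr fmul0r sub0r fmul_gen opprK.
Qed.

Lemma K0_spanMl x y : K0_span x -> K0_span (fmul x y).
Proof.
elim=> {x} [|x1 x2 _ h1 _ h2|A B D i p hip].
- by rewrite fmul0l; exact: K0_span0.
- by rewrite fmulBl; exact: K0_spanB.
elim/fgen_ind: y => [|y1 y2 h1 h2|X].
- by rewrite fmul0r; exact: K0_span0.
- by rewrite fmulBr; exact: K0_spanB.
by rewrite fmul_genB; exact: (K0_span_conflation (ten_exactl X hip)).
Qed.

Lemma K0_spanMr x y : K0_span y -> K0_span (fmul x y).
Proof.
elim=> {y} [|y1 y2 _ h1 _ h2|A B D i p hip].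
- by rewrite fmul0r; exact: K0_span0.
- by rewrite fmulBr; exact: K0_spanB.
elim/fgen_ind: x => [|x1 x2 h1 h2|X].
- by rewrite fmul0l; exact: K0_span0.
- by rewrite fmulBl; exact: K0_spanB.
by rewrite fmul_genBr; exact: (K0_span_conflation (ten_exactr X hip)).
Qed.

Lemma K0_mul_pi x y : K0_mul (K0_pi x) (K0_pi y) = K0_pi (fmul x y).
Proof.
rewrite /K0_mul.
have h z : K0_span (repr (K0_pi z) - z) by apply/K0_piP; rewrite K0_piK.
apply/K0_piP.
have -> : fmul (repr (K0_pi x)) (repr (K0_pi y)) - fmul x y =
    fmul (repr (K0_pi x) - x) (repr (K0_pi y)) -
    fmul x (y - repr (K0_pi y)).
  by rewrite fmulBl fmulBr opprB addrA subrK.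
apply: K0_spanB; first exact: K0_spanMl.
by apply: K0_spanMr; rewrite -opprB -sub0r; apply: K0_spanB => //; exact: K0_span0.
Qed.

Lemma K0_ind (Q : K0 -> Prop) :
  Q 0 -> (forall x y, Q x -> Q y -> Q (x - y)) -> (forall A, Q (cls A)) ->
  forall x, Q x.
Proof.
move=> Q0 QB Qg x; rewrite -[x]K0_piK.
elim/fgen_ind: (repr x) => [|y z hy hz|A]; last exact: Qg.
  by rewrite K0_pi0.
by rewrite K0_piB; apply: QB.
Qed.

Lemma K0_mulBl : left_distributive K0_mul (fun x y => x - y).
Proof.
move=> x y z; rewrite -[x]K0_piK -[y]K0_piK -[z]K0_piK -K0_piB !K0_mul_pi.
by rewrite fmulBl K0_piB.
Qed.

Lemma K0_mulBr : right_distributive K0_mul (fun x y => x - y).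
Proof.
move=> x y z; rewrite -[x]K0_piK -[y]K0_piK -[z]K0_piK -K0_piB !K0_mul_pi.
by rewrite fmulBr K0_piB.
Qed.

Lemma K0_mul0l x : K0_mul 0 x = 0.
Proof. by have := K0_mulBl 0 0 x; rewrite !subrr. Qed.

Lemma K0_mul0r x : K0_mul x 0 = 0.
Proof. by have := K0_mulBr x 0 0; rewrite !subrr. Qed.

Lemma K0_mul_cls A B : K0_mul (cls A) (cls B) = cls (ten A B).
Proof. by rewrite K0_mul_pi fmul_gen. Qed.

Lemma K0_mulA : associative K0_mul.
Proof.
move=> x y z; elim/K0_ind: x => [|x1 x2 h1 h2|A].
- by rewrite !K0_mul0l.
- by rewrite !K0_mulBl h1 h2.
elim/K0_ind: y => [|y1 y2 h1 h2|B].
- by rewrite K0_mul0l !K0_mul0r K0_mul0l.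
- by rewrite K0_mulBl !K0_mulBr K0_mulBl h1 h2.
elim/K0_ind: z => [|z1 z2 h1 h2|D].
- by rewrite !K0_mul0r.
- by rewrite !K0_mulBr h1 h2.
by rewrite !K0_mul_cls; exact: cls_iso (tassoc_iso A B D).
Qed.

Lemma K0_mulC : commutative K0_mul.
Proof.
move=> x y; elim/K0_ind: x => [|x1 x2 h1 h2|A].
- by rewrite K0_mul0l K0_mul0r.
- by rewrite K0_mulBl K0_mulBr h1 h2.
elim/K0_ind: y => [|y1 y2 h1 h2|B].
- by rewrite K0_mul0l K0_mul0r.
- by rewrite K0_mulBl K0_mulBr h1 h2.
by rewrite !K0_mul_cls; exact: cls_iso (braid_iso A B).
Qed.

Lemma K0_mul1 : left_id (cls tunit) K0_mul.
Proof.
elim/K0_ind=> [|x1 x2 h1 h2|A].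
- by rewrite K0_mul0r.
- by rewrite K0_mulBr h1 h2.
by rewrite K0_mul_cls; exact: cls_iso (unitl_iso A).
Qed.

Lemma K0_mulDl : left_distributive K0_mul +%R.
Proof.
move=> x y z; rewrite -{1}[y]opprK K0_mulBl -[- y]sub0r K0_mulBl K0_mul0l.
by rewrite sub0r opprK.
Qed.

HB.instance Definition _ := GRing.Zmodule_isComPzRing.Build K0
  K0_mulA K0_mulC K0_mul1 K0_mulDl.

Lemma clsM A B : cls (ten A B) = cls A * cls B.
Proof. by rewrite -K0_mul_cls. Qed.

Lemma cls1 : cls tunit = 1.
Proof. by []. Qed.

End K0Group.

(* Complexes are indexed by nat, the terms in negative degrees being zero. *)
Record complex (C : preadditive) := Complex {
  cterm :> nat -> C;
  cdiff : forall i, hom (cterm i.+1) (cterm i);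
  cdiff_cdiff : forall i, cdiff i ∘ cdiff i.+1 = 0
}.

Definition bounded (C : preadditive) (M : complex C) :=
  exists n, forall i, (n <= i)%N -> is_zero_obj (M i).

Record chain_map (C : preadditive) (M N : complex C) := ChainMap {
  cmap :> forall i, hom (M i) (N i);
  cmap_cdiff : forall i, cdiff N i ∘ cmap i.+1 = cmap i ∘ cdiff M i
}.

Section Preadditive.
Variable C : preadditive.

Lemma comp0m (A B D : C) (f : hom A B) : (0 : hom B D) ∘ f = 0.
Proof. by apply: (addrI (0 ∘ f)); rewrite -compDl !addr0. Qed.

Lemma compm0 (A B D : C) (g : hom B D) : g ∘ (0 : hom A B) = 0.
Proof. by apply: (addrI (g ∘ 0)); rewrite -compDr !addr0. Qed.

Lemma compNm (A B D : C) (g : hom B D) (f : hom A B) : (- g) ∘ f = - (g ∘ f).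
Proof. by apply: (addrI (g ∘ f)); rewrite -compDl !subrr comp0m. Qed.

Lemma compmN (A B D : C) (g : hom B D) (f : hom A B) : g ∘ (- f) = - (g ∘ f).
Proof. by apply: (addrI (g ∘ f)); rewrite -compDr !subrr compm0. Qed.

Lemma compMzl (A B D : C) (g : hom B D) (f : hom A B) k :
  (g *~ k) ∘ f = (g ∘ f) *~ k.
Proof.
have natE n : (g *+ n) ∘ f = (g ∘ f) *+ n.
  by elim: n => [|n IHn]; rewrite ?mulr0n ?comp0m // !mulrS compDl IHn.
by case: k => n; [exact: natE | rewrite !NegzE !mulrNz compNm natE].
Qed.

Lemma compMzr (A B D : C) (g : hom B D) (f : hom A B) k :
  g ∘ (f *~ k) = (g ∘ f) *~ k.
Proof.
have natE n : g ∘ (f *+ n) = (g ∘ f) *+ n.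
  by elim: n => [|n IHn]; rewrite ?mulr0n ?compm0 // !mulrS compDr IHn.
by case: k => n; [exact: natE | rewrite !NegzE !mulrNz compmN natE].
Qed.

Lemma comp_suml (A B D : C) n (g : nat -> hom B D) (f : hom A B) :
  (\sum_(i < n) g i) ∘ f = \sum_(i < n) (g i ∘ f).
Proof.
by elim: n => [|n IHn]; rewrite ?big_ord0 ?comp0m // !big_ord_recr compDl IHn.
Qed.

Lemma comp_sumr (A B D : C) n (g : hom B D) (f : nat -> hom A B) :
  g ∘ (\sum_(i < n) f i) = \sum_(i < n) (g ∘ f i).
Proof.
by elim: n => [|n IHn]; rewrite ?big_ord0 ?compm0 // !big_ord_recr compDr IHn.
Qed.

(* [kron X i j] is the identity if i = j and 0 otherwise; [mdiff M i j] is the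
   differential if i = j + 1 and 0 otherwise. *)
Definition kron (X : nat -> C) (i j : nat) : hom (X i) (X j) :=
  if i =P j is ReflectT e then ecast k (hom (X i) (X k)) e (idm (X i)) else 0.

Definition mdiff (M : complex C) (i j : nat) : hom (M i) (M j) :=
  if j.+1 =P i is ReflectT e then ecast k (hom (M k) (M j)) e (cdiff M j) else 0.

Lemma kron_id X i : kron X i i = idm (X i).
Proof. by rewrite /kron; case: eqP => // e; rewrite eq_axiomK. Qed.

Lemma kron_neq X i j : i != j -> kron X i j = 0.
Proof. by rewrite /kron; case: eqP. Qed.

Lemma mdiff_succ M j : mdiff M j.+1 j = cdiff M j.
Proof. by rewrite /mdiff; case: eqP => // e; rewrite eq_axiomK. Qed.

Lemma mdiff_neq M i j : i != j.+1 -> mdiff M i j = 0.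
Proof. by rewrite /mdiff; case: eqP => // e; rewrite -[X in X != _]e eqxx. Qed.

Lemma mdiff_mdiff M i j k : mdiff M j k ∘ mdiff M i j = 0.
Proof.
have [->|/mdiff_neq->] := eqVneq i j.+1; last by rewrite compm0.
have [->|/mdiff_neq->] := eqVneq j k.+1; last by rewrite comp0m.
by rewrite !mdiff_succ cdiff_cdiff.
Qed.

End Preadditive.

Section DirectSum.
Variable C : additive_cat.

Fixpoint dsum (n : nat) (X : nat -> C) : C :=
  if n is n'.+1 then biprod (dsum n' X) (X n') else zob.

Fixpoint dsum_out (n : nat) (X : nat -> C) (Y : C) (f : forall i, hom (X i) Y) :
    hom (dsum n X) Y :=
  if n is n'.+1 then
    dsum_out n' f ∘ projl (dsum n' X) (X n') + f n' ∘ projr (dsum n' X) (X n')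
  else 0.

Fixpoint dsum_in (n : nat) (X : C) (Y : nat -> C) (f : forall j, hom X (Y j)) :
    hom X (dsum n Y) :=
  if n is n'.+1 then
    injl (dsum n' Y) (Y n') ∘ dsum_in n' f + injr (dsum n' Y) (Y n') ∘ f n'
  else 0.

(* The morphism with matrix f, whose entry f i j maps the i-th summand of the
   source to the j-th summand of the target. *)
Definition mxmap (n m : nat) (X Y : nat -> C) (f : forall i j, hom (X i) (Y j)) :
    hom (dsum n X) (dsum m Y) :=
  dsum_out n (fun i => dsum_in m (f i)).

Lemma dsum_out_in n (A B : C) (X : nat -> C) (f : forall i, hom (X i) B)
    (g : forall i, hom A (X i)) :
  dsum_out n f ∘ dsum_in n g = \sum_(i < n) (f i ∘ g i).
Proof.
elim: n => [|n IHn] /=; first by rewrite comp0m big_ord0.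
rewrite big_ord_recr /= -IHn compDl !compDr -!compA.
rewrite ![projl _ _ ∘ (_ ∘ _)]compA ![projr _ _ ∘ (_ ∘ _)]compA.
rewrite projl_injl projl_injr projr_injl projr_injr.
by rewrite !comp0m !compm0 !comp1m addr0 add0r.
Qed.

Lemma comp_dsum_out n (A B : C) (X : nat -> C) (f : forall i, hom (X i) A)
    (g : hom A B) :
  g ∘ dsum_out n f = dsum_out n (fun i => g ∘ f i).
Proof.
by elim: n => [|n IHn] /=; rewrite ?compm0 // compDr !compA IHn.
Qed.

Lemma dsum_in_comp n (A B : C) (Y : nat -> C) (f : forall i, hom B (Y i))
    (g : hom A B) :
  dsum_in n f ∘ g = dsum_in n (fun i => f i ∘ g).
Proof.
by elim: n => [|n IHn] /=; rewrite ?comp0m // compDl -!compA IHn.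
Qed.

Lemma dsum_out_eq0 n (A : C) (X : nat -> C) (f : forall i, hom (X i) A) :
  (forall i, (i < n)%N -> f i = 0) -> dsum_out n f = 0.
Proof.
elim: n => //= n IHn f0; rewrite f0 // comp0m IHn ?comp0m ?addr0 //.
by move=> i lt_in; apply: f0; apply: ltnW.
Qed.

Lemma dsum_in_eq0 n (A : C) (Y : nat -> C) (f : forall i, hom A (Y i)) :
  (forall i, (i < n)%N -> f i = 0) -> dsum_in n f = 0.
Proof.
elim: n => //= n IHn f0; rewrite f0 // compm0 IHn ?compm0 ?addr0 //.
by move=> i lt_in; apply: f0; apply: ltnW.
Qed.

Lemma dsum_out_mxmap n m (X Y : nat -> C) (A : C) (f : forall j, hom (Y j) A)
    (g : forall i j, hom (X i) (Y j)) :
  dsum_out m f ∘ mxmap n m g = dsum_out n (fun i => \sum_(j < m) (f j ∘ g i j)).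
Proof.
rewrite /mxmap comp_dsum_out; elim: n => //= n ->.
by rewrite dsum_out_in.
Qed.

Lemma mxmap_comp_eq0 n m l (X Y Z : nat -> C)
    (f : forall i j, hom (X i) (Y j)) (g : forall j k, hom (Y j) (Z k)) :
  (forall i k, (i < n)%N -> (k < l)%N -> \sum_(j < m) (g j k ∘ f i j) = 0) ->
  mxmap m l g ∘ mxmap n m f = 0.
Proof.
move=> gf0; rewrite [mxmap m l g]/mxmap dsum_out_mxmap.
apply: dsum_out_eq0 => i lt_in.
rewrite (eq_bigr (fun j : 'I_m => dsum_in l (fun k => g j k ∘ f i j))); last first.
  by move=> j _; rewrite dsum_in_comp.
have -> : \sum_(j < m) dsum_in l (fun k => g j k ∘ f i j) =
    dsum_in l (fun k => \sum_(j < m) (g j k ∘ f i j)).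
  elim: l {gf0} => [|l IHl] /=; first by rewrite big1.
  rewrite big_split /= -IHl (comp_sumr _ _ (fun j => g j l ∘ f i j)).
  by rewrite (comp_sumr _ _ (fun j => dsum_in l (fun k => g j k ∘ f i j))).
by apply: dsum_in_eq0 => k lt_kl; exact: gf0.
Qed.

End DirectSum.

Section Cone.
Variable (C : additive_cat) (N : complex C) (phi : chain_map N N).

(* With (CN)_i+1 = N_i+1 + N_i, the differential is
   (x, y) |-> (dx + phi y, - dy). *)
Definition cone_term (i : nat) : C :=
  if i is i'.+1 then biprod (N i'.+1) (N i') else N 0%N.

Definition cone_diff (i : nat) : hom (cone_term i.+1) (cone_term i) :=
  match i with
  | 0%N => cdiff N 0%N ∘ projl (N 1%N) (N 0%N) + phi 0%N ∘ projr (N 1%N) (N 0%N)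
  | i'.+1 =>
      injl (N i'.+1) (N i') ∘
        (cdiff N i'.+1 ∘ projl (N i'.+2) (N i'.+1) +
         phi i'.+1 ∘ projr (N i'.+2) (N i'.+1))
      - injr (N i'.+1) (N i') ∘ (cdiff N i' ∘ projr (N i'.+2) (N i'.+1))
  end.

Lemma projl_cone_diff i : projl _ _ ∘ cone_diff i.+1 =
  cdiff N i.+1 ∘ projl (N i.+2) (N i.+1) + phi i.+1 ∘ projr (N i.+2) (N i.+1).
Proof.
by rewrite /= compDr compmN !compA projl_injl projl_injr comp1m !comp0m subr0.
Qed.

Lemma projr_cone_diff i : projr _ _ ∘ cone_diff i.+1 =
  - (cdiff N i ∘ projr (N i.+2) (N i.+1)).
Proof.
by rewrite /= compDr compmN !compA projr_injl projr_injr comp1m !comp0m sub0r.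
Qed.

Lemma cone_diff_diff0 i :
  (cdiff N i ∘ projl _ _ + phi i ∘ projr _ _) ∘ cone_diff i.+1 = 0.
Proof.
rewrite compDl -!compA projl_cone_diff projr_cone_diff compDr compmN !compA.
by rewrite cdiff_cdiff comp0m add0r cmap_cdiff subrr.
Qed.

Lemma cone_diff_diff i : cone_diff i ∘ cone_diff i.+1 = 0.
Proof.
case: i => [|i]; first exact: cone_diff_diff0.
rewrite [cone_diff i.+1]/= compDl compNm -!compA cone_diff_diff0 compm0 sub0r.
by rewrite projr_cone_diff compmN compA cdiff_cdiff comp0m oppr0 compm0 oppr0.
Qed.

Definition cone : complex C := Complex cone_diff_diff.

End Cone.

Inductive iterated_cone (C : additive_cat) (N : complex C) :
    nat -> complex C -> Prop :=
| iterated_cone0 : iterated_cone N 0%N N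
| iterated_coneS j (M : complex C) (phi : chain_map M M) :
    iterated_cone N j M -> iterated_cone N j.+1 (cone phi).

Section TensorComplex.
Variables (P : tensor_cat) (M N : complex P).

Lemma tenm0l (A A' B B' : P) (g : hom B B') : tenm (0 : hom A A') g = 0.
Proof. by apply: (addrI (tenm 0 g)); rewrite -tenmDl !addr0. Qed.

Lemma tenm0r (A A' B B' : P) (f : hom A A') : tenm f (0 : hom B B') = 0.
Proof. by apply: (addrI (tenm f 0)); rewrite -tenmDr !addr0. Qed.

Definition tens_summand (n a : nat) : P := ten (M a) (N (n - a)%N).

Definition tens_term (n : nat) : P := dsum n.+1 (tens_summand n).

(* d(x ⊗ y) = dx ⊗ y + (-1)^a x ⊗ dy for x in M_a *)
Definition tens_entry (n a a' : nat) :
    hom (tens_summand n.+1 a) (tens_summand n a') :=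
  tenm (mdiff M a a') (kron N (n.+1 - a)%N (n - a')%N)
  + tenm (kron M a a') (mdiff N (n.+1 - a)%N (n - a')%N) *~ ((-1) ^+ a).

Definition tens_diff (n : nat) : hom (tens_term n.+1) (tens_term n) :=
  mxmap n.+2 n.+1 (tens_entry n).

Lemma tens_diff_diff n : tens_diff n ∘ tens_diff n.+1 = 0.
Proof.
apply: mxmap_comp_eq0 => a c lt_a lt_c.
pose s b := tenm (mdiff M b c ∘ kron M a b)
                 (kron N (n.+1 - b)%N (n - c)%N ∘ mdiff N (n.+2 - a)%N (n.+1 - b)%N)
            *~ ((-1) ^+ a).
pose t b := tenm (kron M b c ∘ mdiff M a b)
                 (mdiff N (n.+1 - b)%N (n - c)%N ∘ kron N (n.+2 - a)%N (n.+1 - b)%N)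
            *~ ((-1) ^+ b).
have -> : \sum_(b < n.+2) (tens_entry n b c ∘ tens_entry n.+1 a b) =
    \sum_(b < n.+2) (s b + t b).
  apply: eq_bigr => b _; rewrite /tens_entry compDl !compDr.
  rewrite !compMzl !compMzr -!tenm_comp !mdiff_mdiff tenm0l tenm0r.
  by rewrite !mul0rz add0r addr0.
rewrite big_split /=.
have st : (\sum_(b < n.+2) t b) = t c.
  rewrite (bigD1 (Ordinal (ltnW lt_c : c < n.+2)%N)) //= big1 ?addr0 // => b nbc.
  by rewrite /t kron_neq // comp0m tenm0l mul0rz.
rewrite st.
have [a_eq|a_neq] := eqVneq a c.+1; last first.
  rewrite big1 => [|b _]; first rewrite add0r /t kron_id comp1m.
    by rewrite mdiff_neq // tenm0l mul0rz.
  rewrite /s; have [<-|nab] := eqVneq a b.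
    by rewrite mdiff_neq // comp0m tenm0l mul0rz.
  by rewrite kron_neq // compm0 tenm0l mul0rz.
subst a; have lt_c1 : (c.+1 < n.+2)%N by [].
rewrite (bigD1 (Ordinal lt_c1)) //= big1 => [|b nbc]; last first.
  by rewrite /s [kron M _ _]kron_neq 1?eq_sym // compm0 tenm0l mul0rz.
rewrite addr0 /s /t /= !kron_id compm1 comp1m.
by rewrite [X in tenm _ X]comp1m [X in _ + tenm _ X *~ _]compm1 exprS mulN1r mulrNz addNr.
Qed.

Definition tens : complex P := Complex tens_diff_diff.

End TensorComplex.

Section Chi.
Variable P : tensor_cat.

Lemma cls_zero_obj (A : P) : is_zero_obj A -> cls A = 0.
Proof.
move=> A0; have [D [p hp]] := inflation_id A.
have hA := cls_conflation hp.
have D0 : cls D = 0 by apply: (addrI (cls A)); rewrite addr0.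
have Aid : idm A = 0 by exact: (A0 A).1.
have [_ /(_ D p)] := conflation_coker hp.
have -> : p = 0 by exact: (A0 D).1.
case=> [|g [_ g_uniq]]; first by rewrite comp0m.
have idD0 : idm D = 0.
  by rewrite -(g_uniq (idm D)) ?compm0 // (g_uniq 0) ?compm0.
rewrite -D0; apply: (@cls_iso _ _ _ (0 : hom A D)).
by exists (0 : hom D A); rewrite comp0m.
Qed.

(* The sums range over the finite support; the class of a zero object is 0,
   so the support is finite when M is bounded. *)
Definition euler (M : complex P) : K0 P :=
  \sum_(i \in [set: nat]) cls (M i) *~ (-1) ^+ i.

Definition chi (j : nat) (M : complex P) : K0 P :=
  \sum_(i \in [set: nat])
    cls (M i) *~ ((-1) ^ (i%:Z - j%:Z) * ('C(i, j))%:Z).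

End Chi.

(* Main.v *)
From mathcomp Require Import all_boot all_order all_algebra.
From mathcomp Require Import ring zify.
From mathcomp Require classical_sets fsbigop.
Require Import Defs.

Set Implicit Arguments.
Unset Strict Implicit.
Unset Printing Implicit Defensive.

Import GRing.Theory.
Local Open Scope ring_scope.

(** The Euler characteristics are additive in the terms of a complex, so they
    only see the classes of these terms, and everything reduces to an identity
    between binomial coefficients.  With c_j(i) = (-1)^(i-j) 'C(i, j) one has
    chi_j(M) = sum_i c_j(i) [M_i]; in other words, chi_j(M) is the j-th Taylor
    coefficient at t = -1 of the polynomial sum_i [M_i] t^i.

    The class of a biproduct is the sum of the classes ([cls_biprod]), so the
    polynomial of a tensor product is the product of the polynomials, and that
    of a cone is the polynomial of N times 1 + t.  Reading off Taylor
    coefficients at -1, where 1 + t is the local parameter, gives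
    - chi_k(M tensor N) = sum_(r + s = k) chi_r(M) chi_s(N) ([chi_tens]), which
      on coefficients is the Vandermonde identity ([chi_coefD]);
    - chi_(j+1)(CN) = chi_j(N) and chi_0(CN) = 0 ([chi_coneS], [chi_cone0]),
      which on coefficients is the Pascal identity ([chi_coefSS],
      [chi_coef0S]).
    If chi_r vanishes on M and N for r < j, both polynomials are divisible by
    (1 + t)^j, and in the convolution formula a term survives only if r >= j
    and s >= j: no term for k < 2j, one for k = 2j, two for k = 2j + 1.  The
    statement on iterated cones follows by induction.  The computation is made
    with finite sums rather than polynomials because K0 may be the zero
    ring. *)

(** * Classes of biproducts in the Grothendieck group *)

(** The kernel of the identity of B, which is a deflation, is a zero object,
    and it comes with an inflation into B. *)
Lemma zero_inflation (C : exact_cat) (B : C) :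
  exists2 Z : C, is_zero_obj Z & exists i : hom Z B, inflation i.
Proof.
have [Z [i hi]] := deflation_id B; exists Z; last by exists i, B, (idm B).
have [i0 hker] := conflation_ker hi; rewrite comp1m in i0.
have from0 X (f : hom X Z) : f = 0.
  have [|g [_ g_uniq]] := hker X 0; first by rewrite compm0.
  by rewrite -(g_uniq f) ?(g_uniq 0) // i0 comp0m.
move=> X; split=> f; last exact: from0.
by rewrite -[f]compm1 (from0 _ (idm Z)) compm0.
Qed.

Section ClassesOfSums.
Variable P : tensor_cat.

(** Split sequences being conflations is not among the axioms.  It is recovered
    by pushing the inflation from a zero object Z into B out along Z -> A: the
    pushout of A and B under a zero object is their biproduct, and the inflation
    A -> E so obtained has cokernel B. *)
Lemma cls_biprod (A B : P) : cls (biprod A B) = cls A + cls B.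
Proof.
have [Z Z0 [z hz]] := zero_inflation B.
have [E [i [b [[_ E_univ] [D [p hp]]]]]] := inflation_pushout (0 : hom Z A) hz.
have [|w [[wi wb] _]] := E_univ _ (injl A B) (injr A B).
  by rewrite ((Z0 _).1 (injl _ _ ∘ _)) ((Z0 _).1 (injr _ _ ∘ _)).
have E_id : (i ∘ projl A B + b ∘ projr A B) ∘ w = idm E.
  have [|u [_ u_uniq]] := E_univ _ i b.
    by rewrite ((Z0 _).1 (i ∘ _)) ((Z0 _).1 (b ∘ _)).
  rewrite -(u_uniq (idm E)) ?comp1m //; apply/esym/u_uniq.
  rewrite -!compA wi wb !compDl -!compA.
  by rewrite projl_injl projl_injr projr_injl projr_injr !compm1 !compm0 addr0 add0r.
have w_iso : is_iso w.
  exists (i ∘ projl A B + b ∘ projr A B); first exact: E_id.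
  by rewrite compDr !compA wi wb biprod_id.
have [pi0 p_univ] := conflation_coker hp.
have [|g [gp _]] := p_univ _ (projr A B ∘ w); first by rewrite -compA wi projr_injl.
(* The inverse of p ∘ b is induced by the projection of E onto B. *)
have pb_iso : is_iso (p ∘ b).
  exists g; first by rewrite compA gp -compA wb projr_injr.
  have [|u [_ u_uniq]] := p_univ _ p; first exact: pi0.
  rewrite -(u_uniq (idm D)) ?comp1m //; apply/esym/u_uniq.
  rewrite -compA gp -{2}[p]compm1 -E_id compDl compDr !compA.
  by rewrite pi0 !comp0m add0r.
by rewrite -(cls_iso w_iso) (cls_iso pb_iso) (cls_conflation hp).
Qed.

Lemma cls_dsum n (X : nat -> P) : cls (dsum n X) = \sum_(i < n) cls (X i).
Proof.
elim: n => [|n IHn]; first by rewrite big_ord0 (cls_zero_obj (@zobP P)).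
by rewrite big_ord_recr /= cls_biprod IHn.
Qed.

End ClassesOfSums.

(** * Rearranging finite sums *)

Section Sums.
Variable V : nmodType.

Lemma sum_ord_trunc p q (f : nat -> V) :
  (p <= q)%N -> (forall i, (p <= i)%N -> f i = 0) ->
  \sum_(i < q) f i = \sum_(i < p) f i.
Proof.
move=> le_pq f0; rewrite -(subnKC le_pq) big_split_ord /= [X in _ + X]big1 ?addr0 //.
by move=> i _; rewrite f0 ?leq_addr.
Qed.

(** Both sides sum f a b over a + b < p: by diagonals on the left, by rows on
    the right. *)
Lemma sum_triangle p (f : nat -> nat -> V) :
  \sum_(k < p) \sum_(a < k.+1) f a (k - a)%N =
  \sum_(a < p) \sum_(b < p - a) f a b.
Proof.
elim: p => [|p IHp]; first by rewrite !big_ord0.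
rewrite big_ord_recr /= IHp !(big_ord_recr p) /= subnn subSnn big_ord1 addrA.
rewrite -big_split /=; congr (_ + _); apply: eq_bigr => a _.
by rewrite subSn 1?ltnW // big_ord_recr.
Qed.

Lemma sum_diagonals m n (f : nat -> nat -> V) :
  (forall a b, (m <= a)%N || (n <= b)%N -> f a b = 0) ->
  \sum_(k < m + n) \sum_(a < k.+1) f a (k - a)%N =
  \sum_(a < m) \sum_(b < n) f a b.
Proof.
move=> f0; rewrite sum_triangle.
rewrite (@sum_ord_trunc m _ (fun a => \sum_(b < m + n - a) f a b)) ?leq_addr //.
  apply: eq_bigr => a _; apply: sum_ord_trunc => [|b le_nb].
    by rewrite addnC -addnBA ?leq_addr // ltnW.
  by rewrite f0 ?le_nb ?orbT.
by move=> a le_ma; rewrite big1 // => b _; rewrite f0 ?le_ma.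
Qed.

End Sums.

(** * The coefficients of the Euler characteristics *)

Definition chi_coef (j i : nat) : int := (-1) ^ (i%:Z - j%:Z) * ('C(i, j))%:Z.

Lemma chi_coefE j i : chi_coef j i = (-1) ^+ (i + j) * ('C(i, j))%:Z.
Proof.
rewrite /chi_coef exprzDr ?unitrN1 // -invr_expz exprD.
by rewrite -[((-1) ^ j%:Z)]/((-1) ^+ j) -exprVn invrN1.
Qed.

Lemma chi_coef0S i : chi_coef 0 i + chi_coef 0 i.+1 = 0.
Proof. by rewrite !chi_coefE !addn0 !bin0 exprS; ring. Qed.

(** The coefficient of (1 + t)^(j+1) in (1 + t) t^i is that of (1 + t)^j in
    t^i. *)
Lemma chi_coefSS j i : chi_coef j.+1 i + chi_coef j.+1 i.+1 = chi_coef j i.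
Proof.
by rewrite !chi_coefE binS PoszD addSn addnS !exprS; ring.
Qed.

(** The expansion of t^(a+b) in powers of 1 + t is the product of those of t^a
    and t^b. *)
Lemma chi_coefD k a b :
  chi_coef k (a + b) = \sum_(r < k.+1) chi_coef r a * chi_coef (k - r) b.
Proof.
rewrite chi_coefE -binomial.Vandermonde (big_morph Posz PoszD (erefl _)) mulr_sumr.
apply: eq_bigr => r _; rewrite !chi_coefE PoszM.
have le_rk : (r <= k)%N by rewrite -ltnS.
rewrite -{1}(subnKC le_rk) addnACA exprD; ring.
Qed.

(** * Euler characteristics of bounded complexes *)

Section BoundedComplexes.
Variable C : additive_cat.
Implicit Types M N : complex C.

Lemma biprod_zero_obj (A B : C) :
  is_zero_obj A -> is_zero_obj B -> is_zero_obj (biprod A B).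
Proof.
move=> A0 B0 X; have id0 : idm (biprod A B) = 0.
  rewrite -biprod_id ((A0 _).2 (projl A B)) ((B0 _).2 (projr A B)).
  by rewrite !compm0 addr0.
by split=> f; [rewrite -[f]compm1|rewrite -[f]comp1m]; rewrite id0 ?compm0 ?comp0m.
Qed.

Lemma bounded_cone N (phi : chain_map N N) : bounded N -> bounded (cone phi).
Proof.
case=> n N0; exists n.+1 => -[|i] // le_ni.
by apply: biprod_zero_obj; apply: N0; rewrite // ltnW.
Qed.

Lemma bounded_iterated_cone N j M :
  iterated_cone N j M -> bounded N -> bounded M.
Proof. by elim=> // j' M' phi _ IH /IH; apply: bounded_cone. Qed.

End BoundedComplexes.

Section Chi.
Variable P : tensor_cat.
Implicit Types M N : complex P.

(** Only the classes of the terms matter for the characteristics, and for tensor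
    products and cones their vanishing propagates through the class formulas. *)
Definition cls_bound n M := forall i, (n <= i)%N -> cls (M i) = 0.

Lemma bounded_cls M : bounded M -> exists n, cls_bound n M.
Proof. by case=> n M0; exists n => i le_ni; apply/cls_zero_obj/M0. Qed.

Lemma chi_sum n M j : cls_bound n M ->
  chi j M = \sum_(i < n) cls (M i) *~ chi_coef j i.
Proof.
move=> M0; rewrite /chi (@fsbigop.fsbigE _ _ _ _ _ (iota 0 n)) ?iota_uniq //.
  rewrite -(big_mkord xpredT (fun i => cls (M i) *~ chi_coef j i)).
  by rewrite /index_iota subn0; apply: eq_bigl => i; rewrite classical_sets.in_setT.
move=> i _; rewrite mem_iota -leqNgt => le_ni.
by rewrite M0 ?mul0rz.
Qed.

Lemma euler_chi0 M : euler M = chi 0 M.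
Proof.
apply: fsbigop.eq_fsbigr => i _.
by rewrite -/(chi_coef 0 i) chi_coefE addn0 bin0 mulr1.
Qed.

Lemma cls_tens M N n :
  cls (tens M N n) = \sum_(a < n.+1) cls (M a) * cls (N (n - a)%N).
Proof. by rewrite cls_dsum; apply: eq_bigr => a _; rewrite clsM. Qed.

Lemma cls_bound_tens m n M N : cls_bound m M -> cls_bound n N ->
  cls_bound (m + n) (tens M N).
Proof.
move=> M0 N0 k le_k; rewrite cls_tens big1 // => a _.
have [/M0->|lt_am] := leqP m a; first by rewrite mul0r.
by rewrite N0 ?mulr0 //; lia.
Qed.

(** Taylor coefficients at -1 of a product of polynomials are given by
    convolution. *)
Lemma chi_tens M N k : bounded M -> bounded N ->
  chi k (tens M N) = \sum_(r < k.+1) chi r M * chi (k - r) N.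
Proof.
move=> /bounded_cls[m M0] /bounded_cls[n N0].
rewrite (chi_sum _ (cls_bound_tens M0 N0)).
pose f a b := (cls (M a) * cls (N b)) *~ chi_coef k (a + b).
transitivity (\sum_(i < m + n) \sum_(a < i.+1) f a (i - a)%N).
  apply: eq_bigr => i _; rewrite cls_tens mulrz_suml; apply: eq_bigr => a _.
  by rewrite /f subnKC // -ltnS.
rewrite sum_diagonals => [|a b]; last first.
  by case/orP=> [/M0|/N0] c0; rewrite /f c0 ?mul0r ?mulr0 mul0rz.
under [RHS]eq_bigr => r _ do rewrite (chi_sum _ M0) (chi_sum _ N0) big_distrlr.
rewrite [RHS]exchange_big; apply: eq_bigr => a _ /=.
rewrite [RHS]exchange_big; apply: eq_bigr => b _ /=.
rewrite /f chi_coefD mulrz_sumr; apply: eq_bigr => r _.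
by rewrite mulrzAl mulrzAr mulrzA [RHS]mulrzAC.
Qed.

Lemma cls_bound_cone n N (phi : chain_map N N) :
  cls_bound n N -> cls_bound n.+1 (cone phi).
Proof.
by move=> N0 [|i] // le_ni; rewrite /= cls_biprod !N0 ?addr0 // ltnW.
Qed.

(** The summand N_i occurs in degrees i and i + 1 of the cone. *)
Lemma chi_cone_sum n N (phi : chain_map N N) j : cls_bound n N ->
  chi j (cone phi) =
  \sum_(i < n) cls (N i) *~ (chi_coef j i + chi_coef j i.+1).
Proof.
move=> N0; rewrite (chi_sum _ (@cls_bound_cone _ _ phi N0)).
under [RHS]eq_bigr do rewrite mulrzDr.
(* The term i = n vanishes; adding it makes both sums below start by splitting
   off their term i = 0, as the cone has no summand N_(-1) in degree 0. *)
have shift : \sum_(i < n) cls (N i) *~ chi_coef j i =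
    \sum_(i < n.+1) cls (N i) *~ chi_coef j i.
  by rewrite big_ord_recr /= N0 // mul0rz addr0.
rewrite big_split /= shift !big_ord_recl /= -addrA; congr (_ + _).
rewrite -big_split; apply: eq_bigr => i _ /=.
by rewrite cls_biprod mulrzDl.
Qed.

Lemma chi_coneS N (phi : chain_map N N) j : bounded N ->
  chi j.+1 (cone phi) = chi j N.
Proof.
case/bounded_cls=> n N0; rewrite (chi_cone_sum _ _ N0) (chi_sum _ N0).
by apply: eq_bigr => i _; rewrite chi_coefSS.
Qed.

Lemma chi_cone0 N (phi : chain_map N N) : bounded N -> chi 0 (cone phi) = 0.
Proof.
case/bounded_cls=> n N0; rewrite (chi_cone_sum _ _ N0) big1 // => i _.
by rewrite chi_coef0S.
Qed.

Lemma chi_iterated_cone N j M k : bounded N -> iterated_cone N j M ->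
  chi (k + j) M = chi k N.
Proof.
move=> Nb; elim=> [|{}j M' phi coneM' IH]; first by rewrite addn0.
by rewrite addnS chi_coneS //; apply: bounded_iterated_cone coneM' Nb.
Qed.

Lemma chi_iterated_cone_eq0 N j M r : bounded N -> iterated_cone N j M ->
  (r < j)%N -> chi r M = 0.
Proof.
move=> Nb coneM; elim: coneM r => // {}j M' phi coneM' IH [|r] lt_rj.
  by apply: chi_cone0; apply: bounded_iterated_cone coneM' Nb.
by rewrite chi_coneS ?IH //; apply: bounded_iterated_cone coneM' Nb.
Qed.

End Chi.

Theorem theorem3p2 (P : tensor_cat) (M N : complex P) (j : nat)
    (Mbounded : bounded M) (Nbounded : bounded N) :
  [/\ (forall r, (r < j)%N -> chi r M = 0) ->
      (forall r, (r < j)%N -> chi r N = 0) ->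
      [/\ forall k, (k < 2 * j)%N -> chi k (tens M N) = 0,
          chi (2 * j) (tens M N) = chi j M * chi j N &
          chi (2 * j + 1) (tens M N) =
            chi j M * chi j.+1 N + chi j.+1 M * chi j N],
      forall phi : chain_map N N, M = cone phi -> chi j.+1 M = chi j N
    & iterated_cone N j M ->
      [/\ chi j M = euler N,
          forall k, chi (k + j) M = chi k N &
          forall r, (r < j)%N -> chi r M = 0]].
Proof.
split=> [M0 N0|phi ->|coneM].
- have term0 k r : ((r < j) || (k - r < j))%N -> chi r M * chi (k - r) N = 0.
    by case/orP=> [/M0|/N0] ->; rewrite ?mul0r ?mulr0.
  split=> [k lt_k||]; rewrite chi_tens //.
  + rewrite big1 // => -[r lt_rk] _; apply: term0 => /=; lia.
  + have lt_j : (j < (2 * j).+1)%N by lia.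
    have sub_j : (2 * j - j)%N = j by lia.
    rewrite (bigD1 (Ordinal lt_j)) //= big1 => [|[r lt_r] ne_rj].
      by rewrite addr0 sub_j.
    by apply: term0; move: ne_rj; rewrite -val_eqE /=; lia.
  have lt_j : (j < (2 * j + 1).+1)%N by lia.
  have lt_j1 : (j.+1 < (2 * j + 1).+1)%N by lia.
  have sub_j : (2 * j + 1 - j)%N = j.+1 by lia.
  have sub_j1 : (2 * j + 1 - j.+1)%N = j by lia.
  rewrite (bigD1 (Ordinal lt_j)) //= (bigD1 (Ordinal lt_j1)) /=; last first.
    by rewrite -val_eqE /=; lia.
  rewrite big1 => [|[r lt_r]]; last first.
    by rewrite -!val_eqE /= => ne_r; apply: term0; lia.
  by rewrite addr0 sub_j sub_j1.
- exact: chi_coneS.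
split=> [|k|r].
- by rewrite euler_chi0 -(chi_iterated_cone 0 Nbounded coneM).
- exact: chi_iterated_cone coneM.
exact: chi_iterated_cone_eq0 coneM.
Qed.
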